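(* The largest eigenvalue of $\Pi=(X+D+Y)^{-1}D(X+Y)^{-1}D(X+D+Y)^{-1}$ is upper bounded by $$\lambda_{\max}(\Pi)\le\lambda_{\max}\big((X+Y)^{-1}\big).$$ That is, $\mathrm{PoSA}_{\max}(X,Y)$ is upper bounded by $\frac12\lambda_{\max}\big((X+Y)^{-1}\big)$.
   Context: Network: a rooted tree with node set $\mathcal N\cup\{0\}$, $\mathcal N=\{1,\dots,n\}$, root $0$ having exactly one child, and set of lines (edges) $\mathcal L$; each line $(h,k)\in\mathcal L$ has reactance $x_{hk}>0$. $\mathcal L_i\subseteq\mathcal L$ is the set of lines on the unique path from $0$ to $i$. The reactance matrix $X\in\mathbb R^{n\times n}$ is $X_{ij}=\sum_{(h,k)\in\mathcal L_i\cap\mathcal L_j}x_{hk}$; it is symmetric positive definite. $D=\mathrm{diag}(X_{11},\dots,X_{nn})$ and $Y=\mathrm{diag}\{y_i\}_{i\in\mathcal N}$ with $y_i>0$. For $\Delta\tilde v\in\mathbb R^n$ let $F(q)=\frac12q^\top(X+Y)q+q^\top\Delta\tilde v$ and $W(q)=\frac12q^\top(X+D+Y)q+q^\top\Delta\tilde v$ on $\mathbb R^n$, with unique minimizers $q^*=-(X+Y)^{-1}\Delta\tilde v$ (network equilibrium of the signal-taking control) and $q^a=-(X+D+Y)^{-1}\Delta\tilde v$ (Nash equilibrium of the signal-anticipating control). The price of signal-anticipation is $\mathrm{PoSA}=F(q^a)-F(q^* )$, and $\mathrm{PoSA}_{\max}(X,Y)=\sup_{\Delta\tilde v\ne0}\frac{\mathrm{PoSA}}{\Delta\tilde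 v^\top\Delta\tilde v}$, which equals $\frac12\lambda_{\max}(\Pi)$. $\lambda_{\max}$ denotes the maximum eigenvalue. *)

(* Defs.v *)
From mathcomp Require Import all_boot all_order all_algebra.
From mathcomp Require Import all_classical all_reals ereal.

Set Implicit Arguments.
Unset Strict Implicit.
Unset Printing Implicit Defensive.

Import Order.TTheory GRing.Theory Num.Theory.
Local Open Scope ring_scope.

(* The nodes are 'I_n.+1: the root is ord0, and the node of index i : 'I_n in
   the vectors and matrices is lift ord0 i.  A line is a pair of nodes; its
   orientation is arbitrary and carries no meaning. *)

Definition adjacent (n : nat) (L : {set 'I_n.+1 * 'I_n.+1}) : rel 'I_n.+1 :=
  fun h k => ((h, k) \in L) || ((k, h) \in L).

(* The first clause excludes loops and lines listed in both orientations. A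
   closed walk of length two along a single line is a ucycle in the sense of
   the library, but not a cycle of the graph. *)
Definition is_tree (n : nat) (L : {set 'I_n.+1 * 'I_n.+1}) : Prop :=
  [/\ forall h k, (h, k) \in L -> (k, h) \notin L,
      forall h k, connect (adjacent L) h k
    & forall c, ucycle (adjacent L) c -> (size c <= 2)%N].

Definition root_has_one_child (n : nat) (L : {set 'I_n.+1 * 'I_n.+1}) : Prop :=
  #|[pred k | adjacent L ord0 k]| = 1%N.

Definition simple_path (n : nat) (L : {set 'I_n.+1 * 'I_n.+1})
    (h k : 'I_n.+1) (p : seq 'I_n.+1) : Prop :=
  [/\ path (adjacent L) h p, last h p = k & uniq (h :: p)].

(* zip (h :: p) p lists the pairs of consecutive nodes of the path h :: p. *)
Definition path_lines (n : nat) (L : {set 'I_n.+1 * 'I_n.+1}) (i : 'I_n) :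
    {set 'I_n.+1 * 'I_n.+1} :=
  [set l in L | `[< exists2 p, simple_path L ord0 (lift ord0 i) p
      & (l \in zip (ord0 :: p) p) || ((l.2, l.1) \in zip (ord0 :: p) p) >]]%SET.

Section Network.
Context {R : realType} {n : nat}.

Definition reactance_mx (L : {set 'I_n.+1 * 'I_n.+1})
    (x : 'I_n.+1 -> 'I_n.+1 -> R) : 'M[R]_n :=
  \matrix_(i, j) \sum_(l in path_lines L i :&: path_lines L j) x l.1 l.2.

Definition diag_part (X : 'M[R]_n) : 'M[R]_n := diag_mx (\row_i X i i).

Definition quad_cost (A : 'M[R]_n) (dv q : 'cV[R]_n) : R :=
  2^-1 * (q^T *m A *m q) 0 0 + (q^T *m dv) 0 0.

Definition signal_taking_cost (X Y : 'M[R]_n) : 'cV[R]_n -> 'cV[R]_n -> R :=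
  quad_cost (X + Y).

Definition signal_anticipating_cost (X Y : 'M[R]_n) :
    'cV[R]_n -> 'cV[R]_n -> R :=
  quad_cost (X + diag_part X + Y).

(* Equal to 0 when there is no minimizer; the two costs above have exactly one
   when X is positive semidefinite and Y is diagonal with positive entries. *)
Definition argmin (f : 'cV[R]_n -> R) : 'cV[R]_n :=
  xget 0 [set q | forall p, f q <= f p]%classic.

Definition PoSA (X Y : 'M[R]_n) (dv : 'cV[R]_n) : R :=
  let F := signal_taking_cost X Y dv in
  let W := signal_anticipating_cost X Y dv in
  F (argmin W) - F (argmin F).

Definition PoSA_max (X Y : 'M[R]_n) : \bar R :=
  ereal_sup [set (PoSA X Y dv / (dv^T *m dv) 0 0)%:E
            | dv in [set dv : 'cV[R]_n | dv != 0]]%classic.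

(* The set of eigenvalues is finite, so the supremum is a maximum as soon as
   there is a real eigenvalue, in particular for symmetric matrices. *)
Definition lambda_max (A : 'M[R]_n) : R := sup [set a | eigenvalue A a]%classic.

Definition Pi_mx (X Y : 'M[R]_n) : 'M[R]_n :=
  let D := diag_part X in
  invmx (X + D + Y) *m D *m invmx (X + Y) *m D *m invmx (X + D + Y).

End Network.

(* Main.v *)
Require Import Defs.
From mathcomp Require Import all_boot all_order all_algebra.
From mathcomp Require Import all_classical all_reals ereal.
From mathcomp Require Import ring lra.

Set Implicit Arguments.
Unset Strict Implicit.
Unset Printing Implicit Defensive.

Import Order.TTheory GRing.Theory Num.Theory.
Local Open Scope ring_scope.

(** Write [A = X + Y], [M = X + D + Y = A + D] and [dv] for the signal.  The
    theorem rests on an inequality between quadratic forms: [Pi] lies below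
    [A^-1].  Since [D = M - A], one has [M^-1 D A^-1 = A^-1 D M^-1 =
    A^-1 - M^-1], and using this twice gives
      [Pi = M^-1 D A^-1 D M^-1 = A^-1 - M^-1 - M^-1 D M^-1].
    The two subtracted matrices are positive semidefinite, because [M] is
    positive definite and [D] is diagonal with nonnegative entries
    ([posa_mx_le]).

    To pass from forms to eigenvalues one needs that a real symmetric matrix [B]
    satisfies [v^T B v <= lambda_max B * v^T v] ([bform_le_lambda_max]), that
    is, that the supremum [m] of its Rayleigh quotient is an eigenvalue
    ([symmetric_max_eigenvalue]).  Otherwise [m I - B] would be invertible; an
    invertible symmetric positive semidefinite matrix is bounded below by a
    positive multiple of the identity ([psd_unit_coercive]), so [m] could be
    lowered.

    For the price of signal-anticipation, completing the square identifies the
    two minimizers as [- A^-1 dv] and [- M^-1 dv]; their difference is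
    [A^-1 D M^-1 dv], and the cost gap is half the form of [Pi] at [dv]
    ([quad_cost_gap]).

    That [A] is positive definite comes from the network: the quadratic form of
    [X] is a sum over the lines of the reactance times a square
    ([bform_reactance]), and [Y] has a positive diagonal. *)

(** * Bilinear forms and positive matrices *)

Section BilinearForms.
Context {R : realType} {n : nat}.
Implicit Types (A B : 'M[R]_n) (u v w : 'cV[R]_n).

Definition bform B u v : R := (u^T *m B *m v) 0 0.
Definition dot u v : R := (u^T *m v) 0 0.
Definition posdef B : Prop := forall v, v != 0 -> 0 < bform B v v.

Lemma bformE B u v : bform B u v = \sum_i \sum_j u i 0 * B i j * v j 0.
Proof.
rewrite /bform -mulmxA mxE; apply: eq_bigr => i _.
by rewrite !mxE big_distrr; apply: eq_bigr => j _ /=; rewrite mulrA.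
Qed.

Lemma dotE u v : dot u v = \sum_i u i 0 * v i 0.
Proof. by rewrite /dot mxE; apply: eq_bigr => i _; rewrite mxE. Qed.

Lemma dot_ge0 v : 0 <= dot v v.
Proof. by rewrite dotE sumr_ge0 // => i _; rewrite -expr2 sqr_ge0. Qed.

Lemma dot_gt0 v : v != 0 -> 0 < dot v v.
Proof.
move=> v0; rewrite lt_neqAle dot_ge0 andbT eq_sym; apply: contraNN v0.
rewrite dotE psumr_eq0 => [/allP v0|i _]; last by rewrite -expr2 sqr_ge0.
apply/eqP/colP => i; rewrite mxE; apply/eqP.
by have := v0 i (mem_index_enum _); rewrite mulf_eq0 orbb.
Qed.

Lemma dotC u v : dot u v = dot v u.
Proof. by rewrite !dotE; apply: eq_bigr => i _; rewrite mulrC. Qed.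

Lemma bform_mulr B u v : bform B u v = dot u (B *m v).
Proof. by rewrite /bform /dot mulmxA. Qed.

Lemma bformC B u v : B^T = B -> bform B u v = bform B v u.
Proof.
by move=> BT; rewrite !bform_mulr dotC /dot trmx_mul BT mulmxA.
Qed.

Lemma bform_addmx A B u v : bform (A + B) u v = bform A u v + bform B u v.
Proof. by rewrite /bform mulmxDr mulmxDl mxE. Qed.

Lemma bform_submx A B u v : bform (A - B) u v = bform A u v - bform B u v.
Proof. by rewrite /bform mulmxBr mulmxBl !mxE. Qed.

Lemma bformDr B u v w : bform B u (v + w) = bform B u v + bform B u w.
Proof. by rewrite /bform mulmxDr mxE. Qed.

Lemma bformDl B u v w : bform B (u + v) w = bform B u w + bform B v w.
Proof. by rewrite /bform linearD /= !mulmxDl mxE. Qed.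

Lemma bformZr B a u v : bform B u (a *: v) = a * bform B u v.
Proof. by rewrite /bform -scalemxAr mxE. Qed.

Lemma bformZl B a u v : bform B (a *: u) v = a * bform B u v.
Proof. by rewrite /bform linearZ /= -!scalemxAl mxE. Qed.

Lemma bform_scalar a u v : bform a%:M u v = a * dot u v.
Proof. by rewrite bform_mulr mul_scalar_mx /dot -scalemxAr mxE. Qed.

Lemma bform0 B u : bform B u 0 = 0.
Proof. by rewrite /bform mulmx0 mxE. Qed.

Lemma posdef_ge0 B v : posdef B -> 0 <= bform B v v.
Proof.
move=> Bpos; have [->|/Bpos/ltW//] := eqVneq v 0.
by rewrite bform0.
Qed.

Lemma bform_congr A B u : bform (A^T *m B *m A) u u = bform B (A *m u) (A *m u).
Proof. by rewrite /bform trmx_mul !mulmxA. Qed.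

(** A crude upper bound on the form: one plus the sum of the absolute values of
    the entries suffices, and adding one makes the constant positive. *)
Lemma bform_le_dot B : exists2 C, 0 < C & forall v, bform B v v <= C * dot v v.
Proof.
pose S := \sum_i \sum_j `|B i j|.
have S0 : 0 <= S by do 2 (apply: sumr_ge0 => ? _); exact: normr_ge0.
exists (1 + S) => [|v]; first by lra.
have sq_le i : v i 0 * v i 0 <= dot v v.
  rewrite dotE (bigD1 i) //= lerDl sumr_ge0 // => j _.
  by rewrite -expr2 sqr_ge0.
rewrite mulrDl mul1r; apply: le_trans (_ : S * dot v v <= _); last first.
  by rewrite lerDr dot_ge0.
rewrite bformE big_distrl /=; apply: ler_sum => i _.
rewrite big_distrl /=; apply: ler_sum => j _.
have := sq_le i; have := sq_le j; move: (v i 0) (v j 0) => a b hb ha.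
(* Each product of two coordinates is at most the mean of their squares. *)
have h1 : a * b <= dot v v by have := sqr_ge0 (a - b); nra.
have h2 : - (a * b) <= dot v v by have := sqr_ge0 (a + b); nra.
rewrite mulrAC mulrC; apply: le_trans (ler_norm _) _.
rewrite normrM; apply: ler_wpM2l => //.
by rewrite ler_norml; apply/andP; split; lra.
Qed.

Lemma posdef_unit B : posdef B -> B \in unitmx.
Proof.
move=> Bpos; rewrite -row_free_unit -kermx_eq0; apply/eqP/row_matrixP => i.
rewrite row0; apply/eqP; apply: contraT => r0.
have /sub_kermxP rB := row_sub i (kermx B).
have := Bpos (row i (kermx B))^T; rewrite /bform trmxK rB mul0mx mxE ltxx.
rewrite -trmx0 (inj_eq trmx_inj).
by move=> /(_ r0).
Qed.

(** With [w = B v], invertibility gives [|v|^2 <= K |w|^2], and [|w|^2] is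
    controlled by [v^T B v]: expanding the nonnegative form at [v - w / C],
    where [C] bounds the form of [B] from above, gives
    [|w|^2 <= C (v^T B v)]. *)
Lemma psd_unit_coercive B : B^T = B -> B \in unitmx ->
  (forall v, 0 <= bform B v v) ->
  exists2 c, 0 < c & forall v, c * dot v v <= bform B v v.
Proof.
move=> BT Bu B0.
have [C C0 hC] := bform_le_dot B.
have [K K0 hK] := bform_le_dot ((invmx B)^T *m invmx B).
exists (K * C)^-1 => [|v]; first by rewrite invr_gt0 mulr_gt0.
pose w := B *m v.
have hv : dot v v <= K * dot w w.
  have -> : v = invmx B *m w by rewrite mulKmx.
  have -> : dot (invmx B *m w) (invmx B *m w)
      = bform ((invmx B)^T *m invmx B) w w.
    by rewrite bform_mulr /dot trmx_mul !mulmxA.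
  exact: hK.
have hw : dot w w <= C * bform B v v.
  have := B0 (v - C^-1 *: w); rewrite -scaleNr.
  rewrite bformDl !bformDr !bformZl !bformZr.
  rewrite (bformC w v BT) !(bform_mulr _ v w).
  have -> : dot v (B *m w) = dot w w.
    by rewrite -bform_mulr bformC // bform_mulr.
  have : C^-1 * (C^-1 * bform B w w) <= C^-1 * dot w w.
    by rewrite ler_pM2l ?invr_gt0 // ler_pdivrMl.
  by rewrite -(ler_pdivrMl _ _ C0); lra.
rewrite ler_pdivrMl ?mulr_gt0 //; apply: le_trans hv _.
by rewrite -mulrA ler_wpM2l // ltW.
Qed.

End BilinearForms.

(** * The Rayleigh principle for symmetric matrices *)

Section LargestEigenvalue.
Context {R : realType} {n : nat}.
Implicit Types (A B : 'M[R]_n).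

(** Eigenvectors are rows for [eigenvalue], whereas the quadratic forms take
    columns. *)
Lemma bform_eigenvector B a (u : 'rV[R]_n) :
  u *m B = a *: u -> bform B u^T u^T = a * dot u^T u^T.
Proof. by move=> uB; rewrite /bform /dot trmxK uB -scalemxAl mxE. Qed.

(** The witness is the supremum [m] of the Rayleigh quotient.  If it were not an
    eigenvalue, coercivity of [m I - B] would make [m - c] an upper bound for
    some [c > 0]. *)
Lemma symmetric_max_eigenvalue B : (0 < n)%N -> B^T = B ->
  exists2 m, eigenvalue B m & forall v, bform B v v <= m * dot v v.
Proof.
move=> n0 BT.
pose S := [set bform B v v / dot v v
          | v in [set v : 'cV[R]_n | v != 0]]%classic.
have [C _ hC] := bform_le_dot B.
have SC : ubound S C.
  by move=> _ [v /= v0 <-]; rewrite ler_pdivrMr ?dot_gt0.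
have S0 : (S !=set0)%classic.
  pose e : 'cV[R]_n := const_mx 1; exists (bform B e e / dot e e).
  exists e => //=; apply/negP => /eqP/colP/(_ (Ordinal n0)).
  by rewrite !mxE => /eqP; rewrite oner_eq0.
have Sm v : bform B v v <= sup S * dot v v.
  have [->|v0] := eqVneq v 0.
    by rewrite bform0 /dot mulmx0 mxE mulr0.
  rewrite -ler_pdivrMr ?dot_gt0 //; apply: ub_le_sup; first by exists C.
  by exists v.
exists (sup S) => //; apply: contraT => not_eig.
pose N := (sup S)%:M - B.
have NT : N^T = N by rewrite /N linearB /= tr_scalar_mx BT.
have Nu : N \in unitmx.
  move: not_eig; rewrite /eigenvalue /eigenspace negbK kermx_eq0 row_free_unit.
  by rewrite -opprB -scaleN1r unitmxZ ?unitrN1.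
have Nf v : bform N v v = sup S * dot v v - bform B v v.
  by rewrite bform_submx bform_scalar.
have N0 v : 0 <= bform N v v by rewrite Nf subr_ge0.
have [c c0 hc] := psd_unit_coercive NT Nu N0.
have : sup S <= sup S - c.
  apply: ge_sup => // _ [v /= v0 <-]; rewrite ler_pdivrMr ?dot_gt0 //.
  by have := hc v; rewrite Nf; lra.
lra.
Qed.

Lemma eigenvalue_le_lambda_max B a : eigenvalue B a -> a <= lambda_max B.
Proof.
move=> Ba; apply: ub_le_sup => //.
have [C _ hC] := bform_le_dot B; exists C => b /= /eigenvalueP[u uB u0].
have u0' : u^T != 0 by rewrite -trmx0 (inj_eq trmx_inj).
have := hC u^T; rewrite (bform_eigenvector uB) ler_pM2r //.
exact: dot_gt0.
Qed.

Lemma bform_le_lambda_max B v :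
  B^T = B -> bform B v v <= lambda_max B * dot v v.
Proof.
move=> BT; have [n0|n_gt0] := posnP n.
  rewrite bformE dotE !big1 ?mulr0 // => i _.
    by have := ltn_ord i; rewrite {2}n0.
  by have := ltn_ord i; rewrite {2}n0.
have [m Bm hm] := symmetric_max_eigenvalue n_gt0 BT.
apply: le_trans (hm v) _; rewrite ler_wpM2r ?dot_ge0 //.
exact: eigenvalue_le_lambda_max.
Qed.

(** In dimension 0 there is no eigenvalue, but the two matrices coincide. *)
Lemma lambda_max_le A B : A^T = A -> B^T = B ->
  (forall v, bform A v v <= bform B v v) -> lambda_max A <= lambda_max B.
Proof.
move=> AT BT AB; have [n0|n_gt0] := posnP n.
  suff -> : A = B by [].
  by apply/matrixP => i; have := ltn_ord i; rewrite {2}n0.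
apply: ge_sup => [|a /= /eigenvalueP[u uA u0]].
  by have [m Am _] := symmetric_max_eigenvalue n_gt0 AT; exists m.
have u0' : u^T != 0 by rewrite -trmx0 (inj_eq trmx_inj).
rewrite -(ler_pM2r (dot_gt0 u0')) -(bform_eigenvector uA).
exact: le_trans (AB _) (bform_le_lambda_max _ BT).
Qed.

End LargestEigenvalue.

(** * Minimizers of quadratic costs and the cost gap *)

Section QuadraticCost.
Context {R : realType} {n : nat}.
Implicit Types (A D : 'M[R]_n) (dv : 'cV[R]_n).

Lemma quad_cost_square A dv p q : A^T = A -> A *m q = - dv ->
  quad_cost A dv p = quad_cost A dv q + 2^-1 * bform A (p - q) (p - q).
Proof.
move=> AT Aq.
have cost r : quad_cost A dv r = 2^-1 * bform A r r - bform A r q.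
  by rewrite (bform_mulr A r q) Aq /dot mulmxN mxE opprK.
rewrite !cost -scaleN1r bformDl !bformDr !bformZl !bformZr (bformC q p AT).
by field.
Qed.

(** A point reached by [argmin] is some minimizer, so it must be shown to be the
    only one: the form of [A] vanishes at its difference with the critical
    point. *)
Lemma argmin_quad_cost A dv : A^T = A -> posdef A ->
  argmin (quad_cost A dv) = - (invmx A *m dv).
Proof.
move=> AT Apos; set q := - _.
have Aq : A *m q = - dv by rewrite mulmxN mulKVmx // posdef_unit.
have q_min p : quad_cost A dv q <= quad_cost A dv p.
  rewrite (quad_cost_square p AT Aq) lerDl mulr_ge0 ?invr_ge0 ?ler0n //.
  exact: posdef_ge0.
rewrite /argmin; case: xgetP => [p _ /= p_min|/(_ q)[]//].
apply/eqP; rewrite -subr_eq0; apply: contraT => /Apos.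
have := p_min q; rewrite (quad_cost_square p AT Aq); lra.
Qed.

(** Both the cost gap and the bound on its matrix come from this identity,
    applied to [M = A + D], where [M - A] is [D]. *)
Lemma invmx_sub A M : A \in unitmx -> M \in unitmx ->
  invmx A *m (M - A) *m invmx M = invmx A - invmx M.
Proof.
by move=> Au Mu; rewrite mulmxBr mulVmx // mulmxBl mul1mx mulmxK.
Qed.

(** The minimizers differ by [w = A^-1 D (A + D)^-1 dv], and the gap is half of
    [w^T A w] because the cost has no first-order term at its minimizer. *)
Lemma quad_cost_gap A D dv : A^T = A -> D^T = D ->
  posdef A -> posdef (A + D) ->
  quad_cost A dv (argmin (quad_cost (A + D) dv))
    - quad_cost A dv (argmin (quad_cost A dv))
  = 2^-1 * bform (invmx (A + D) *m D *m invmx A *m D *m invmx (A + D)) dv dv.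
Proof.
move=> AT DT Apos Mpos; have MT : (A + D)^T = A + D by rewrite linearD /= AT DT.
have [Au Mu] := (posdef_unit Apos, posdef_unit Mpos).
rewrite !argmin_quad_cost //; set M := A + D.
have Aq : A *m - (invmx A *m dv) = - dv by rewrite mulmxN mulKVmx.
rewrite (quad_cost_square _ AT Aq) addrC addKr; congr (_ * _).
have -> : - (invmx M *m dv) - - (invmx A *m dv) = invmx A *m D *m invmx M *m dv.
  have -> : D = M - A by rewrite /M addrC addKr.
  by rewrite invmx_sub // mulmxBl opprK addrC.
rewrite -bform_congr !trmx_mul DT !trmx_inv AT MT; congr (bform _ _ _).
by rewrite !mulmxA mulmxKV.
Qed.

(** With [M = A + D], the matrix on the left equals
    [A^-1 - M^-1 - M^-1 D M^-1], and both subtracted terms are positive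
    semidefinite: [M^-1 = M^-1 M M^-1] is congruent to [M], and the other to
    [D]. *)
Lemma posa_mx_le A D v : A^T = A -> D^T = D ->
  posdef A -> (forall u, 0 <= bform D u u) ->
  bform (invmx (A + D) *m D *m invmx A *m D *m invmx (A + D)) v v
    <= bform (invmx A) v v.
Proof.
move=> AT DT Apos D0.
have Mpos : posdef (A + D).
  by move=> u /Apos A0; rewrite bform_addmx ltr_wpDr.
have [Au Mu] := (posdef_unit Apos, posdef_unit Mpos).
have MT : (A + D)^T = A + D by rewrite linearD /= AT DT.
set M := A + D in Mpos Mu MT *; have DE : D = M - A by rewrite /M addrC addKr.
have QDP : invmx M *m D *m invmx A = invmx A - invmx M.
  rewrite -opprB -invmx_sub // DE -opprB.
  by rewrite mulmxN mulNmx.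
have PDQ : invmx A *m D *m invmx M = invmx A - invmx M.
  by rewrite DE invmx_sub.
have -> : invmx M *m D *m invmx A *m D *m invmx M
    = invmx A - invmx M - (invmx M)^T *m D *m invmx M.
  by rewrite QDP mulmxBl mulmxBl PDQ trmx_inv MT.
have QM : invmx M = (invmx M)^T *m M *m invmx M.
  by rewrite trmx_inv MT mulVmx // mul1mx.
rewrite 2!bform_submx bform_congr {1}QM bform_congr.
have := D0 (invmx M *m v).
have := posdef_ge0 (invmx M *m v) Mpos; lra.
Qed.

Lemma bform_diag (d : 'rV[R]_n) v :
  bform (diag_mx d) v v = \sum_i d 0 i * v i 0 ^+ 2.
Proof.
rewrite bform_mulr dotE; apply: eq_bigr => i _.
by rewrite mul_diag_mx !mxE; ring.
Qed.

End QuadraticCost.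

(** * The reactance matrix *)

Section Reactance.
Context {R : realType} {n : nat} (L : {set 'I_n.+1 * 'I_n.+1})
  (x : 'I_n.+1 -> 'I_n.+1 -> R).

Lemma reactance_mx_tr : (reactance_mx L x)^T = reactance_mx L x.
Proof. by apply/matrixP => i j; rewrite !mxE finset.setIC. Qed.

Lemma reactance_mx_ge0 i j :
  (forall h k, (h, k) \in L -> 0 < x h k) -> 0 <= reactance_mx L x i j.
Proof.
move=> x_gt0; rewrite mxE sumr_ge0 // => -[h k].
by rewrite !inE => /andP[/andP[/x_gt0/ltW]].
Qed.

(** [X] is the sum over the lines [l] of [x_l] times the rank-one matrix
    [e_l e_l^T], where [e_l] is the indicator vector of the nodes whose path
    from the root uses [l]. *)
Lemma bform_reactance v : bform (reactance_mx L x) v v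
  = \sum_(l in L) x l.1 l.2 * (\sum_(i | l \in path_lines L i) v i 0) ^+ 2.
Proof.
have XE i j : reactance_mx L x i j
    = \sum_(l in L) x l.1 l.2 * (l \in path_lines L i)%:R
                              * (l \in path_lines L j)%:R.
  rewrite mxE big_mkcond [RHS]big_mkcond /=; apply: eq_bigr => l _.
  rewrite !inE; case: (l \in L) => //=.
  by do 2 case: asboolP => _; rewrite ?andbF ?mulr0 ?mulr1.
rewrite bformE.
under eq_bigr => i _ do under eq_bigr => j _ do
  rewrite XE mulr_sumr mulr_suml.
under eq_bigr => i _ do rewrite exchange_big /=.
rewrite exchange_big /=; apply: eq_bigr => l _.
rewrite expr2 [in RHS]big_mkcond mulr_suml mulr_sumr; apply: eq_bigr => i _.
rewrite !mulr_sumr; apply: eq_bigr => j _ /=.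
by do 2 case: (_ \in path_lines _ _); rewrite /=; ring.
Qed.

End Reactance.

Theorem theorem6 (R : realType) (n : nat) (L : {set 'I_n.+1 * 'I_n.+1})
    (x : 'I_n.+1 -> 'I_n.+1 -> R) (y : 'I_n -> R)
    (L_tree : is_tree L)
    (L_root : root_has_one_child L)
    (x_gt0 : forall h k, (h, k) \in L -> 0 < x h k)
    (y_gt0 : forall i, 0 < y i) :
  let X := reactance_mx L x in
  let Y := diag_mx (\row_i y i) in
  lambda_max (Pi_mx X Y) <= lambda_max (invmx (X + Y)) /\
  (PoSA_max X Y <= (2^-1 * lambda_max (invmx (X + Y)))%:E)%E.
Proof.
move=> X Y.
pose D := diag_part X; pose A := X + Y.
have AT : A^T = A by rewrite /A linearD /= reactance_mx_tr tr_diag_mx.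
have DT : D^T = D by rewrite /D tr_diag_mx.
have Apos : posdef A.
  move=> v v0; rewrite bform_addmx ltr_wpDl //.
    rewrite bform_reactance sumr_ge0 // => -[h k] /x_gt0/ltW xl.
    by rewrite mulr_ge0 ?sqr_ge0.
  have [i vi0] : exists i, v i 0 != 0.
    apply/existsP; apply: contraNT v0 => /existsPn v0.
    by apply/eqP/colP => i; rewrite mxE; apply/eqP; move: (v0 i); rewrite negbK.
  have term_ge0 j : 0 <= (\row_i y i) 0 j * v j 0 ^+ 2.
    by rewrite mxE mulr_ge0 ?sqr_ge0 // ltW.
  rewrite bform_diag (bigD1 i) //= ltr_pwDl ?sumr_ge0 //.
  by rewrite mxE mulr_gt0 // exprn_even_gt0.
have D0 v : 0 <= bform D v v.
  rewrite bform_diag sumr_ge0 // => i _.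
  by rewrite mxE mulr_ge0 ?sqr_ge0 // reactance_mx_ge0.
have Mpos : posdef (A + D) by move=> v /Apos v0; rewrite bform_addmx ltr_wpDr.
have ME : X + D + Y = A + D by rewrite addrAC.
have PiE : Pi_mx X Y
    = invmx (A + D) *m D *m invmx A *m D *m invmx (A + D).
  by rewrite /Pi_mx -/D ME.
have Pi_le v : bform (Pi_mx X Y) v v <= bform (invmx A) v v.
  by rewrite PiE; apply: posa_mx_le.
have AinvT : (invmx A)^T = invmx A by rewrite trmx_inv AT.
have PiT : (Pi_mx X Y)^T = Pi_mx X Y.
  by rewrite PiE !trmx_mul !trmx_inv linearD /= DT AT !mulmxA.
split; first exact: lambda_max_le.
apply: ge_ereal_sup => _ [dv /= dv0 <-]; rewrite lee_fin.
rewrite ler_pdivrMr ?dot_gt0 // /PoSA /signal_taking_cost.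
rewrite /signal_anticipating_cost -/D ME quad_cost_gap // -PiE -mulrA.
rewrite ler_wpM2l ?invr_ge0 //; apply: le_trans (Pi_le dv) _.
exact: bform_le_lambda_max.
Qed.
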